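(* Let $\omega\in C^1(M,\mathbb{R})$, let $\phi^t\in\mathrm{Diff}^1(M)$ be the flow of $\mathcal{V}$, and let $T_m\phi^{t}$ denote the differential of $\phi^{t}$ at $m\in M$. Let $\sigma[A]_{\min}$ denote the smallest eigenvalue of $A$. Suppose there exist $c\in(0,1)$ and $K>0$ such that $$\sup_{m\in M}\|T_m\phi^{-t}\|\le Ke^{c\,\sigma[A]_{\min}t}\ \text{ for all } t\ge0,\qquad \sup_{m\in M}\|D\omega(m)\|<\infty,\qquad \sup_{m\in M}\|\omega(m)\|<\infty .$$ Then the $\mathbb{R}^N$-generalised synchronisation $$f_{(\omega,\mathcal{V},F)}(m)=\int_0^\infty e^{-A\tau}C\,\omega\phi^{-\tau}(m)\,d\tau$$ of the linear reservoir system $\dot{x}(t)=-Ax(t)+C\,\omega\phi^t(m)$ is of class $C^1(M,\mathbb{R}^N)$.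
   Context: $M$ is a smooth manifold, equipped with a Riemannian metric with respect to which the norms of the differentials $T_m\phi^{-t}$ and $D\omega(m)$ are taken. $\mathcal{V}$ is a smooth vector field on $M$ with evolution operators (flow) $\{\phi^t\in\mathrm{Diff}^1(M)\mid t\in\mathbb{R}\}$, defined for all times and satisfying $\phi^{t_1+t_2}=\phi^{t_1}\phi^{t_2}$. Juxtaposition denotes composition, e.g. $\omega\phi^t(m)=\omega(\phi^t(m))$. $A$ is a real symmetric positive definite $N\times N$ matrix, $C$ is a real $N\times1$ matrix (a vector in $\mathbb{R}^N$), and the reservoir map is $F(x,z)=-Ax+Cz$. $\|\cdot\|$ on $\mathbb{R}^N$ is the Euclidean norm. A map $f:M\to\mathbb{R}^N$ is an $\mathbb{R}^N$-generalised synchronisation if for every $r\in\mathbb{R}^N$, $m\in M$, the solution $x^r_m$ of the system with $x^r_m(0)=r$ satisfies $\lim_{t\to\infty}\|f\phi^t(m)-x^r_m(t)\|=0$. *)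

(* Defs.v *)
From HB Require Import structures.
From mathcomp Require Import all_boot all_order all_algebra.
From mathcomp Require Import all_classical all_reals all_analysis.
Set Implicit Arguments.
Unset Strict Implicit.
Unset Printing Implicit Defensive.
Import Order.TTheory GRing.Theory Num.Theory.
Import numFieldNormedType.Exports.
Local Open Scope classical_set_scope.
Local Open Scope ring_scope.

(* Throughout, R^n is 'cV[R]_n. *)

(* Meant for U open and V finite-dimensional: there, continuity of
   x |-> 'd f x v for every v is continuity of x |-> 'd f x. *)
Fixpoint Ck (R : realType) (V W : normedModType R) (k : nat) (U : set V)
    (f : V -> W) : Prop :=
  match k with
  | 0 => forall x, U x -> {for x, continuous f}
  | k.+1 => (forall x, U x -> differentiable f x) /\
            (forall v, Ck k U (fun x => 'd f x v))
  end.

Definition Csmooth (R : realType) (V W : normedModType R) (U : set V)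
    (f : V -> W) : Prop :=
  forall k, Ck k U f.

(* Only the restrictions of chart_fun to chart_dom and of chart_inv to the
   image of chart_dom are meaningful. *)
Record chart (R : realType) (n : nat) (M : topologicalType) := Chart {
  chart_dom : set M ;
  chart_fun :> M -> 'cV[R]_n ;
  chart_inv : 'cV[R]_n -> M ;
  chart_dom_open : open chart_dom ;
  chart_img_open : open (chart_fun @` chart_dom) ;
  chart_funK : forall m, chart_dom m -> chart_inv (chart_fun m) = m ;
  chart_fun_continuous :
    forall m, chart_dom m -> {for m, continuous chart_fun} ;
  chart_inv_continuous :
    forall x, (chart_fun @` chart_dom) x -> {for x, continuous chart_inv}
}.

(* chart_at picks one atlas chart around each point; it serves only to
   trivialise the individual tangent spaces, see tangent below. *)
Record smooth_manifold (R : realType) (n : nat) (M : topologicalType) :=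
  SmoothManifold {
  atlas : set (chart R n M) ;
  atlas_smooth : forall c c', atlas c -> atlas c' ->
    Csmooth (c @` (chart_dom c `&` chart_dom c')) (c' \o chart_inv c) ;
  chart_at : M -> chart R n M ;
  chart_at_atlas : forall m, atlas (chart_at m) ;
  chart_at_dom : forall m, chart_dom (chart_at m) m ;
  manifold_hausdorff : hausdorff_space M ;
  manifold_second_countable : @second_countable M
}.

Section Manifold.
Context (R : realType) (n : nat) (M : topologicalType).
Variable X : smooth_manifold R n M.

(* A tangent vector at m is given by its coordinates in chart_at X m. *)
Definition tangent (m : M) : Type := 'cV[R]_n.

(* The vector with coordinates v in the chart c, at the point of coordinates x
   in c, as an element of the tangent space at that point. *)
Definition of_chart (c : chart R n M) (x : 'cV[R]_n) (v : 'cV[R]_n) :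
    tangent (chart_inv c x) :=
  'd (chart_at X (chart_inv c x) \o chart_inv c) x v.

(* The coordinates in the chart c of a tangent vector v at m. *)
Definition to_chart (c : chart R n M) (m : M) (v : tangent m) : 'cV[R]_n :=
  'd (c \o chart_inv (chart_at X m)) (chart_at X m m) v.

Definition C1_fun (W : normedModType R) (f : M -> W) : Prop :=
  forall c, atlas X c -> Ck 1 (c @` chart_dom c) (f \o chart_inv c).

Definition C1_map (h : M -> M) : Prop :=
  continuous h /\
  forall c c', atlas X c -> atlas X c' ->
    Ck 1 (c @` (chart_dom c `&` h @^-1` chart_dom c')) (c' \o h \o chart_inv c).

Definition C1_diffeo (h : M -> M) : Prop :=
  exists h' : M -> M, [/\ cancel h h', cancel h' h, C1_map h & C1_map h'].

Definition tangent_fun (W : normedModType R) (f : M -> W) (m : M)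
    (v : tangent m) : W :=
  'd (f \o chart_inv (chart_at X m)) (chart_at X m m) v.

Definition tangent_map (h : M -> M) (m : M) (v : tangent m) : tangent (h m) :=
  'd (chart_at X (h m) \o h \o chart_inv (chart_at X m)) (chart_at X m m) v.

Definition smooth_vector_field (V : forall m, tangent m) : Prop :=
  forall c, atlas X c ->
    Csmooth (c @` chart_dom c)
      (fun x => to_chart c (V (chart_inv c x))).

(* The continuity of t |-> phi t m keeps phi s m in the chart around phi t m
   for s close to t, which the differential equation needs. *)
Definition is_flow (V : forall m, tangent m) (phi : R -> M -> M) : Prop :=
  [/\ forall m, phi 0 m = m,
      forall t1 t2 m, phi (t1 + t2) m = phi t1 (phi t2 m),
      forall m, continuous (fun t => phi t m) &
      forall m t, is_derive t (1 : R)
        (fun s => chart_at X (phi t m) (phi s m)) (V (phi t m))].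

End Manifold.

Definition bform (R : realType) (n : nat) (A : 'M[R]_n) (x y : 'cV[R]_n) : R :=
  (x^T *m A *m y) 0 0.

Definition sym_posdef (R : realType) (n : nat) (A : 'M[R]_n) : Prop :=
  A^T = A /\ forall x : 'cV[R]_n, x != 0 -> 0 < bform A x x.

(* metric_gram m is the Gram matrix of the inner product on the tangent space
   at m, in the coordinates of chart_at X m. *)
Record riemannian_metric (R : realType) (n : nat) (M : topologicalType)
    (X : smooth_manifold R n M) := RiemannianMetric {
  metric_gram : M -> 'M[R]_n ;
  metric_sym_posdef : forall m, sym_posdef (metric_gram m) ;
  metric_smooth : forall c, atlas X c -> forall u v : 'cV[R]_n,
    Csmooth (c @` chart_dom c)
      (fun x => bform (metric_gram (chart_inv c x))
                  (of_chart X c x u) (of_chart X c x v))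
}.

Definition metric_norm (R : realType) (n : nat) (M : topologicalType)
    (X : smooth_manifold R n M) (g : riemannian_metric X) (m : M)
    (v : tangent R n m) : R :=
  Num.sqrt (bform (metric_gram g m) v v).

Definition op_norm (R : realType) (V W : Type) (p : V -> R) (q : W -> R)
    (L : V -> W) : \bar R :=
  ereal_sup [set (q (L v))%:E | v in [set v | p v <= 1]].

Definition tangent_map_norm (R : realType) (n : nat) (M : topologicalType)
    (X : smooth_manifold R n M) (g : riemannian_metric X) (h : M -> M)
    (m : M) : \bar R :=
  op_norm (@metric_norm _ _ _ _ g m) (@metric_norm _ _ _ _ g (h m))
    (@tangent_map _ _ _ X h m).

Definition tangent_fun_norm (R : realType) (n : nat) (M : topologicalType)
    (X : smooth_manifold R n M) (g : riemannian_metric X)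
    (W : normedModType R) (f : M -> W) (m : M) : \bar R :=
  op_norm (@metric_norm _ _ _ _ g m) (fun w : W => `|w|)
    (@tangent_fun _ _ _ X W f m).

(* `|x| is the sup norm on 'cV[R]_N. *)
Definition enorm (R : realType) (N : nat) (x : 'cV[R]_N) : R :=
  Num.sqrt (\sum_(i < N) x i 0 ^+ 2).

Definition expmx (R : realType) (N : nat) (A : 'M[R]_N) : 'M[R]_N :=
  lim (series (fun k : nat => (k`!%:R)^-1 *: A ^+ k) @ \oo).

(* The set of eigenvalues is finite, and for N > 0 and A symmetric it is
   nonempty, so that the infimum is then a minimum. *)
Definition min_eigenvalue (R : realType) (N : nat) (A : 'M[R]_N) : R :=
  inf [set a | eigenvalue A a].

Section Reservoir.
Context (R : realType) (N : nat) (M : Type).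
Variables (phi : R -> M -> M) (omega : M -> R).

Definition linear_reservoir (A : 'M[R]_N) (C : 'cV[R]_N)
    (x : 'cV[R]_N) (z : R) : 'cV[R]_N :=
  - (A *m x) + z *: C.

Definition reservoir_solution (F : 'cV[R]_N -> R -> 'cV[R]_N)
    (r : 'cV[R]_N) (m : M) (x : R -> 'cV[R]_N) : Prop :=
  x 0 = r /\
  forall t, is_derive t (1 : R) x (F (x t) (omega (phi t m))).

Definition generalised_synchronisation (F : 'cV[R]_N -> R -> 'cV[R]_N)
    (f : M -> 'cV[R]_N) : Prop :=
  forall r m,
    (exists x, reservoir_solution F r m x) /\
    (forall x, reservoir_solution F r m x ->
       enorm (f (phi t m) - x t) @[t --> +oo] --> (0 : R)).

Definition sync_integrand (A : 'M[R]_N) (C : 'cV[R]_N) (m : M) (tau : R) :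
    'cV[R]_N :=
  expmx (- (tau *: A)) *m (omega (phi (- tau) m) *: C).

(* The integral of a vector-valued function is taken entrywise. *)
Definition sync_map (A : 'M[R]_N) (C : 'cV[R]_N) (m : M) : 'cV[R]_N :=
  \col_(i < N) Rintegral (@lebesgue_measure R) `[0, +oo[
    (fun tau => sync_integrand A C m tau i 0).

End Reservoir.

(* Main.v *)
(** Resolve the identity as [1 = \sum_l P l] with [A *m P l = d l *: P l].  Then
    [expmx (- (t *: A)) = \sum_l expR (- (d l * t)) *: P l], and the
    synchronisation is a combination of the constant vectors [P l *m C] with the
    scalar weights
      h_a(m) = \int_0^oo e^{-a t} omega(phi^{-t} m) dt,   a = d l >= sigma,
    where sigma is the least eigenvalue.  Along an orbit h_a solves
    y' = omega - a y, so that [f \o phi] solves the reservoir equation, and the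
    difference u of two solutions satisfies (P_l u)' = - d_l P_l u, so decays.
    For the regularity of h_a, the chain rule through the tangent spaces bounds
    the differential of e^{-a t} omega(phi^{-t} m) by a constant times
    e^{(c sigma - a) t}, locally uniformly in a chart.  As c sigma < a this is
    integrable, and one may differentiate under the integral sign by dominated
    convergence.  Nothing is assumed on the dependence of T phi^t on t: its
    measurability comes from difference quotients. *)
Require Import Defs.
From HB Require Import structures.
From mathcomp Require Import all_boot all_order all_algebra.
From mathcomp Require Import all_classical all_reals all_analysis.
From mathcomp Require Import measurable_realfun complex spectral ring lra.
Set Implicit Arguments.
Unset Strict Implicit.
Unset Printing Implicit Defensive.
Import Order.TTheory GRing.Theory Num.Theory.
Import numFieldNormedType.Exports.
Local Open Scope classical_set_scope.
Local Open Scope ring_scope.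

(** * Spectral resolution of a real symmetric matrix *)

Lemma complexRe_sum (R : rcfType) (I : finType) (F : I -> R[i]) :
  complex.Re (\sum_i F i) = \sum_i complex.Re (F i).
Proof. by elim/big_rec2: _ => //= i y1 y2 _ <-; case: (F i); case: y2. Qed.

Lemma complexReM_real (R : rcfType) (a : R) (z : R[i]) :
  complex.Re (a%:C%C * z) = a * complex.Re z.
Proof. by case: z => x y; rewrite /= mul0r subr0. Qed.

(* [P l] is the real part of the l-th rank-one projector of the unitary
   diagonalisation over R[i]: as [A] and [d] are real, taking real parts
   preserves all the equations. *)
Lemma symmetric_spectral_resolution (R : rcfType) (N : nat) (A : 'M[R]_N) :
  A^T = A ->
  exists (P : 'I_N -> 'M[R]_N) (d : 'I_N -> R),
    [/\ \sum_l P l = 1%:M,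
        forall l, A *m P l = d l *: P l,
        forall l, P l *m A = d l *: P l &
        forall l, eigenvalue A (d l)].
Proof.
move=> Asym; pose AC := map_mx (real_complex R) A.
have ACherm : AC \is hermsymmx.
  apply: realsym_hermsym.
    by apply/is_hermitianmxP; rewrite expr0 scale1r map_mx_id // map_trmx Asym.
  by apply/mxOverP => i j; rewrite mxE complex_real.
pose U := spectralmx AC; pose D := spectral_diag AC.
have ACE : AC = invmx U *m diag_mx D *m U.
  exact/orthomx_spectralP/hermitian_normalmx.
have Uu : U \in unitmx by exact: spectral_unit.
pose d l := complex.Re (D 0 l).
have dE l : (d l)%:C%C = D 0 l.
  by apply: RRe_real; exact/mxOverP/hermitian_spectral_diag_real.
pose P l := map_mx (@complex.Re R) (col l (invmx U) *m row l U).
exists P, d; split => [|l|l|l].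
- apply/matrixP => i j; rewrite summxE.
  transitivity (complex.Re ((invmx U *m U) i j)); last first.
    by rewrite mulVmx // !mxE; case: (i == j).
  rewrite mxE complexRe_sum; apply: eq_bigr => l _.
  by rewrite mxE mxE big_ord1 !mxE.
- have H : AC *m col l (invmx U) = (d l)%:C%C *: col l (invmx U).
    rewrite dE [in LHS]colE mulmxA {1}ACE -!mulmxA (mulmxA U) mulmxV //.
    rewrite mul1mx mulmxA -colE; apply/matrixP => i j.
    by rewrite mxE mul_mx_diag !mxE mulrC.
  apply/matrixP => i j.
  apply: (@etrans _ _ (complex.Re ((AC *m (col l (invmx U) *m row l U)) i j))).
    rewrite !mxE complexRe_sum; apply: eq_bigr => k _.
    by rewrite [X in _ = complex.Re (X * _)]mxE complexReM_real mxE.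
  by rewrite mulmxA H -scalemxAl mxE complexReM_real [RHS]mxE [P l _ _]mxE.
- have H : row l U *m AC = (d l)%:C%C *: row l U.
    rewrite -row_mul ACE !mulmxA mulmxV // mul1mx dE.
    by apply/matrixP => i j; rewrite mxE mul_diag_mx !mxE.
  apply/matrixP => i j.
  apply: (@etrans _ _ (complex.Re ((col l (invmx U) *m row l U *m AC) i j))).
    rewrite !mxE complexRe_sum; apply: eq_bigr => k _.
    by rewrite [X in _ = complex.Re (_ * X)]mxE [in RHS]mulrC complexReM_real
      mxE mulrC.
  by rewrite -mulmxA H -scalemxAr mxE complexReM_real [RHS]mxE [P l _ _]mxE.
- suff: eigenvalue AC (d l)%:C%C.
    by rewrite !eigenvalue_root_char -map_char_poly fmorph_root.
  apply/eigenvalueP; exists (row l U).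
    rewrite -row_mul ACE !mulmxA mulmxV // mul1mx dE.
    by apply/matrixP => i j; rewrite mxE mul_diag_mx !mxE.
  apply/eqP => U0; have := congr1 (fun B => row l B) (mulmxV Uu).
  rewrite row_mul U0 mul0mx => /matrixP/(_ 0 l); rewrite !mxE eqxx => /eqP.
  by rewrite eq_sym oner_eq0.
Qed.

(** * Antiderivatives and exponentially weighted integrals on half-lines *)

Lemma continuous_antiderivative (R : realType) (f : R -> R) :
  continuous f -> exists F : R -> R, forall x, is_derive x (1 : R) F (f x).
Proof.
move=> cf; pose mu := @lebesgue_measure R.
have intf a b : mu.-integrable `[a, b] (EFin \o f).
  apply: continuous_compact_integrable; first exact: segment_compact.
  exact: continuous_subspaceT.
pose G (a x : R) := Rintegral mu `[a, x] f.
(* The fundamental theorem only sees points to the right of a fixed base point. Here the base point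
   [- (|x| + 1)] moves with [x] so as to lie to the left of both [x] and 0; subtracting the integral
   up to 0 makes the value independent of that choice. *)
pose F x := G (- (`|x| + 1)) x - G (- (`|x| + 1)) 0.
exists F => x0; pose a := - (`|x0| + 2).
have Gsplit (b x : R) : a <= b -> b <= x -> G a x - G a b = G b x.
  move=> ab bx; rewrite /G Rintegral_itvB ?bnd_simp //.
  rewrite Rintegral_itv_obnd_cbnd //.
  apply: integrableS (intf b x) => //; exact: subset_itv_oc_cc.
(* If [x] is within distance 1 of [x0], its base point is at least [a = - (|x0| + 2)], so near [x0]
   the function [F] is an integral with the fixed base point [a], up to a constant. *)
have FE : \near x0, G a x0 - G a 0 = F x0.
  near=> x.
  have ax : a <= - (`|x| + 1).
    rewrite /a lerN2 -lerBrDr (_ : _ - _ = `|x0| + 1); last by ring.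
    rewrite -(subrK x0 x) addrC (le_trans (ler_normD _ _)) // lerD2l.
    rewrite distrC; near: x; exact: cvgr_dist_le.
  have xb : - (`|x| + 1) <= x.
    by have := ler_norm (- x); rewrite normrN; lra.
  have b0 : - (`|x| + 1) <= 0 by have := normr_ge0 x; lra.
  by rewrite /F -(Gsplit _ x ax xb) -(Gsplit _ _ ax b0); ring.
apply: (@near_eq_is_derive _ _ _ (fun x => G a x - G a 0) _ _ _ _ FE).
have ax0 : a < x0 by have := ler_norm (- x0); rewrite normrN /a; lra.
have x01 : x0 < x0 + 1 by lra.
have [dG GE] := continuous_FTC1_closed x01 (intf a _) ax0 (cf x0).
rewrite derive1E in GE.
have H : is_derive x0 (1 : R) (G a) (f x0) by rewrite -GE; exact: derivableP.
by apply: is_derive_eq; rewrite subr0.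
Unshelve. all: by end_near. Qed.

Lemma is_derive_expR_linear (R : realType) (a x : R) :
  is_derive x (1 : R) (fun y => expR (a * y)) (a * expR (a * x)).
Proof.
by apply: is_derive_eq; rewrite /GRing.scale /= mulr1 mulrC.
Qed.

Lemma measurable_expRN_linear (R : realType) (a : R) (D : set R) :
  measurable_fun D (fun x => expR (- (a * x))).
Proof.
apply: measurable_funTS; apply: measurableT_comp; first exact: measurable_expR.
by apply: measurableT_comp => //; exact: measurable_funM.
Qed.

Lemma cvgr_expRN_linear (R : realType) (a : R) : 0 < a ->
  expR (- (a * x)) @[x --> +oo] --> (0 : R).
Proof.
move=> a0; apply: (@cvg_comp _ _ _ (fun x => a * x) (fun x => expR (- x))).
  exact: (gt0_cvgMry a0 cvg_id).
exact: cvgr_expR.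
Qed.

Lemma integral_expRN_tail (R : realType) (a T : R) : 0 < a ->
  (\int[lebesgue_measure]_(x in `[T, +oo[) (expR (- (a * x)))%:E =
   (a^-1 * expR (- (a * T)))%:E)%E.
Proof.
move=> a0; pose F x := - a^-1 * expR (- a * x).
have dF x : is_derive x (1 : R) F (expR (- (a * x))).
  have H := is_derive_expR_linear (- a) x.
  apply: is_derive_eq; rewrite /GRing.scale /= mulrA mulrNN mulVf ?lt0r_neq0 //.
  by rewrite mul1r mulNr.
rewrite (@ge0_continuous_FTC2y R _ F T 0) //.
- by rewrite -EFinB /F sub0r -mulNr opprK mulNr.
- apply: continuous_subspaceT => x; apply: continuous_comp; last exact: continuous_expR.
  by apply: continuousN; apply: continuousM; [exact: cst_continuous|exact: id].
- rewrite -(mulr0 (- a^-1)); apply: cvgMr => /=.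
  by under eq_fun do rewrite mulNr; exact: cvgr_expRN_linear.
- apply: cvg_at_right_filter; apply: differentiable_continuous.
  exact/derivable1_diffP.
- by move=> x _; rewrite derive1E; apply: derive_val.
Qed.

Lemma integrable_expRN_dominated (R : realType) (f : R -> R) (a B T : R) :
  0 < a -> measurable_fun `[T, +oo[ f ->
  (forall x, T <= x -> `|f x| <= B * expR (- (a * x))) ->
  (@lebesgue_measure R).-integrable `[T, +oo[ (EFin \o f).
Proof.
move=> a0 mf fB; apply: (@le_integrable _ _ R lebesgue_measure `[T, +oo[ _ _
  (fun x => B%:E * (expR (- (a * x)))%:E)%E) => //.
- exact/measurable_EFinP.
- move=> x /=; rewrite in_itv /= andbT => Tx.
  by rewrite lee_fin (le_trans (fB x Tx)) // ler_norm.
- apply: integrableZl => //; apply/integrableP; split.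
    by apply/measurable_EFinP; exact: measurable_expRN_linear.
  under eq_integral do rewrite /= ger0_norm ?expR_ge0 //.
  by rewrite integral_expRN_tail // ltry.
Qed.

Lemma Rintegral_expRN_dominated (R : realType) (f : R -> R) (a B T : R) :
  0 < a -> measurable_fun `[T, +oo[ f ->
  (forall x, T <= x -> `|f x| <= B * expR (- (a * x))) ->
  `|Rintegral (@lebesgue_measure R) `[T, +oo[ f| <=
    B * (a^-1 * expR (- (a * T))).
Proof.
move=> a0 mf fB; have fi := integrable_expRN_dominated a0 mf fB.
have ei : (@lebesgue_measure R).-integrable `[T, +oo[
    (EFin \o (fun x => expR (- (a * x)))).
  apply: (@integrable_expRN_dominated R _ a 1) => //.
    exact: measurable_expRN_linear.
  by move=> x _; rewrite mul1r ger0_norm ?expR_ge0.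
apply: le_trans (le_normr_Rintegral _ fi) _ => //.
apply: le_trans (_ : Rintegral lebesgue_measure `[T, +oo[
  (fun x => B * expR (- (a * x))) <= _).
  apply: le_Rintegral => //.
  - exact: integrable_norm fi.
  - exact: (integrableZl _ B ei).
  - by move=> x /=; rewrite in_itv /= andbT => /fB.
by rewrite RintegralZl // /Rintegral integral_expRN_tail.
Qed.

Lemma continuous_expR_linear (R : realType) (a : R) :
  continuous (fun x : R => expR (a * x)).
Proof.
move=> x; apply: differentiable_continuous; apply/derivable1_diffP.
by have [] := is_derive_expR_linear a x.
Qed.

Lemma continuous_expRN_mul (R : realType) (a s : R) (w : R -> R) :
  continuous w -> continuous (fun x : R => expR (- (a * x)) * w (s - x)).
Proof.
move=> cw; under eq_fun do rewrite -mulNr; move=> x.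
apply: cvgM; first exact: continuous_expR_linear.
apply: (@continuous_comp _ _ _ (fun x => s - x) w); last exact: cw.
by apply: cvgB; [exact: cvg_cst|exact: cvg_id].
Qed.

Lemma measurable_expRN_mul (R : realType) (a s : R) (w : R -> R) (D : set R) :
  measurable D -> continuous w ->
  measurable_fun D (fun x => expR (- (a * x)) * w (s - x)).
Proof.
move=> mD cw; apply: measurable_funTS; apply: continuous_measurable_fun.
exact: continuous_expRN_mul.
Qed.

(** * The differential equation of an exponential convolution *)

Section exponential_convolution.
Variables (R : realType) (a B : R) (w : R -> R).
Hypotheses (a0 : 0 < a) (cw : continuous w) (wB : forall s, `|w s| <= B).

Let H s := Rintegral (@lebesgue_measure R) `[0, +oo[
  (fun x => expR (- (a * x)) * w (s - x)).

Let bound s x : `|expR (- (a * x)) * w (s - x)| <= B * expR (- (a * x)).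
Proof. by rewrite normrM (ger0_norm (expR_ge0 _)) mulrC ler_wpM2r ?expR_ge0. Qed.

Lemma integrable_exponential_convolution s :
  (@lebesgue_measure R).-integrable `[0, +oo[
    (EFin \o (fun x => expR (- (a * x)) * w (s - x))).
Proof.
apply: (@integrable_expRN_dominated _ _ a B) => //.
exact: measurable_expRN_mul.
Qed.

(** As W' = e^{a x} w(x), the function - e^{- a s} W(s - x) of x is an antiderivative of the
    integrand. *)
Let truncated (W : R -> R) s T :
  (forall x, is_derive x (1 : R) W (expR (a * x) * w x)) -> 0 < T ->
  Rintegral (@lebesgue_measure R) `[0, T] (fun x => expR (- (a * x)) * w (s - x)) =
  expR (- (a * s)) * (W s - W (s - T)).
Proof.
move=> dW T0; pose F x := - expR (- (a * s)) * W (s - x).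
have dF x : is_derive x (1 : R) F (expR (- (a * x)) * w (s - x)).
  have dg : is_derive x (1 : R) (fun x => s - x) (- 1).
    by apply: is_derive_eq; rewrite add0r mul1r.
  have dWg := @is_derive1_comp _ W (fun x => s - x) x _ _ (dW (s - x)) dg.
  apply: is_derive_eq; rewrite /GRing.scale /=.
  rewrite mulrN1 mulrNN mulrA -expRD; congr (expR _ * _); ring.
rewrite /Rintegral (@continuous_FTC2 _ _ F 0 T) //=.
- by rewrite /F subr0; ring.
- by apply: continuous_subspaceT; exact: continuous_expRN_mul.
- have cF x : {for x, continuous F}.
    by apply: differentiable_continuous; apply/derivable1_diffP; exact: ex_derive.
  split => [x _||]; first exact: ex_derive.
    by apply: cvg_at_right_filter; exact: cF.
  by apply: cvg_at_left_filter; exact: cF.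
- by move=> x _; rewrite derive1E derive_val.
Qed.

(* If W' = e^{a s} w(s), then e^{a s} H(s) - W(s) is the limit of - W at -oo,
   hence does not depend on s. *)
Lemma is_derive_exponential_convolution t :
  is_derive t (1 : R) H (w t - a * H t).
Proof.
have [W dW] : exists W : R -> R, forall x, is_derive x (1 : R) W (expR (a * x) * w x).
  apply: continuous_antiderivative => x; apply: cvgM; last exact: cw.
  exact: continuous_expR_linear.
pose D s := expR (a * s) * H s - W s.
(* [D s + W u] is e^{a s} times the tail of the integral [H s] beyond s - u. The tail is at most B/a
   e^{- a (s - u)} in absolute value, so the factor e^{a s} cancels and the bound no longer depends
   on [s]. *)
have DW s u : u < s -> `|D s + W u| <= B / a * expR (a * u).
  move=> us; have T0 : 0 < s - u by rewrite subr_gt0.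
  have HT : H s - expR (- (a * s)) * (W s - W u) =
      Rintegral lebesgue_measure `[s - u, +oo[
        (fun x => expR (- (a * x)) * w (s - x)).
    have -> : W u = W (s - (s - u)) by congr W; ring.
    rewrite -truncated // /H Rintegral_itvB ?bnd_simp ?ltW //; last first.
      exact: integrable_exponential_convolution.
    rewrite Rintegral_itv_obnd_cbnd //.
    apply: integrableS (integrable_exponential_convolution s) => //.
    by apply: subset_itvr; rewrite bnd_simp ltW.
  have := @Rintegral_expRN_dominated _ (fun x => expR (- (a * x)) * w (s - x))
    a B (s - u) a0 (measurable_expRN_mul _ _ (measurable_itv _) cw)
    (fun x _ => bound s x).
  rewrite -HT => HB.
  have -> : D s + W u = expR (a * s) * (H s - expR (- (a * s)) * (W s - W u)).
    by rewrite /D mulrBr mulrA -expRD subrr expR0; ring.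
  rewrite normrM (ger0_norm (expR_ge0 _)).
  apply: le_trans (ler_wpM2l (expR_ge0 _) HB) _.
  rewrite le_eqVlt; apply/orP; left; apply/eqP.
  have -> : expR (a * u) = expR (a * s) * expR (- (a * (s - u))).
    by rewrite -expRD; congr expR; ring.
  by ring.
have Dcst s : D s = D t.
  apply/eqP; rewrite -subr_eq0 -normr_le0; apply/ler_addgt0Pr => e e0; rewrite add0r.
  have e2 : 0 < e / 2 by rewrite divr_gt0.
  have lim0 : B / a * expR (- (a * x)) @[x --> +oo] --> (0 : R).
    rewrite -(mulr0 (B / a)); apply: cvgMr; exact: cvgr_expRN_linear.
  have small : \forall x \near +oo, B / a * expR (- (a * x)) <= e / 2.
    move/cvgrPdist_le : lim0 => /(_ _ e2); apply: filterS => x.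
    by rewrite sub0r normrN; exact: le_trans (ler_norm _).
  near (pinfty_nbhs R) => x.
  have xs : - x < s by rewrite ltrNl; near: x; apply: nbhs_pinfty_gt; exact: num_real.
  have xt : - x < t by rewrite ltrNl; near: x; apply: nbhs_pinfty_gt; exact: num_real.
  have xe : B / a * expR (a * - x) <= e / 2.
    by rewrite mulrN; near: x.
  have -> : D s - D t = (D s + W (- x)) - (D t + W (- x)) by ring.
  rewrite (le_trans (ler_normB _ _)) // (splitr e) lerD //.
    exact: le_trans (DW _ _ xs) xe.
  exact: le_trans (DW _ _ xt) xe.
have HE : H = fun s => expR (- a * s) * (W s + D t).
  apply/funext => s; rewrite -(Dcst s) /D.
  have E : expR (- a * s) * expR (a * s) = 1.
    by rewrite -expRD mulNr addrC subrr expR0.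
  by rewrite -[LHS]mul1r -E; ring.
have dH : is_derive t (1 : R) (fun s => expR (- a * s) * (W s + D t)) (w t - a * H t).
  have dE := is_derive_expR_linear (- a) t.
  apply: is_derive_eq; rewrite /GRing.scale /= HE.
  have E : expR (- a * t) * expR (a * t) = 1.
    by rewrite -expRD mulNr addrC subrr expR0.
  by rewrite -[in RHS](mul1r (w t)) -E; ring.
by rewrite -HE in dH.
Unshelve. all: by end_near. Qed.

End exponential_convolution.

(** * Differentiation under the integral sign *)

(* Reduces limits along the filter of neighbourhoods to limits of sequences, for
   which dominated convergence is available. *)
Lemma cvg_seq_near (R : realType) (V W : normedModType R) (F : V -> W) (P : set V)
    (x0 : V) (l : W) :
  (forall y : nat -> V, (forall k, P (y k)) -> y k @[k --> \oo] --> x0 ->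
     F (y k) @[k --> \oo] --> l) ->
  forall e, 0 < e -> \forall y \near x0, P y -> `|l - F y| <= e.
Proof.
move=> Fseq e e0; apply: contrapT => nF.
(* If the bound failed near [x0], every ball of radius 1/(k+1) would contain a point of [P]
   violating it. Choosing one for each k gives a sequence in [P] that tends to [x0] and contradicts
   the hypothesis. *)
have pick k : exists y : V, [/\ P y, ball x0 k.+1%:R^-1 y & e < `|l - F y|].
  apply: contrapT => nk; apply: nF; apply/nbhs_ballP.
  exists k.+1%:R^-1 => /=; first by rewrite invr_gt0.
  move=> y xy Py; rewrite leNgt; apply/negP => ey; apply: nk; exists y.
  by split.
have [y yP] := choice pick.
have yx : y k @[k --> \oo] --> x0.
  apply/cvgrPdist_lt => d d0; near=> k.
  have [_ + _] := yP k; rewrite -ball_normE /= => /lt_trans; apply.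
  by near: k; exact: near_infty_natSinv_lt (PosNum d0).
have := Fseq y (fun k => let: And3 h _ _ := yP k in h) yx.
move=> /cvgrPdist_le/(_ _ e0) [N _ /(_ N)] /=; rewrite leqnn => /(_ isT).
by have [_ _ h] := yP N; rewrite leNgt h.
Unshelve. all: by end_near. Qed.

Lemma is_derive_along_line (R : realType) (V W : normedModType R) (f : V -> W)
    (x h : V) (s : R) : differentiable f (s *: h + x) ->
  is_derive s (1 : R) (fun t => f (t *: h + x)) ('d f (s *: h + x) h).
Proof.
move=> df.
have dl : is_diff s (fun t : R => t *: h + x) (fun t => t *: h).
  by apply: is_diff_eq; rewrite addr0.
have dls : differentiable (fun t : R => t *: h + x) s by exact: ex_diff.
have dfl : differentiable (f \o (fun t : R => t *: h + x)) s.
  exact: differentiable_comp.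
apply: DeriveDef; first exact: diff_derivable.
by rewrite deriveE // diff_comp //= diff_val scale1r.
Qed.

(** This turns a bound on differentials along a segment into a bound on increments, as needed to
    dominate difference quotients. *)
Lemma mean_value_bound (R : realType) (V : normedModType R) (f : V -> R)
    (x h : V) (B : R) :
  (forall s, 0 <= s <= 1 -> differentiable f (s *: h + x)) ->
  (forall s, 0 <= s <= 1 -> `|'d f (s *: h + x) h| <= B) ->
  `|f (h + x) - f x| <= B.
Proof.
move=> df fB.
have dg (s : R) : 0 <= s <= 1 ->
    is_derive s (1 : R) (fun t => f (t *: h + x)) ('d f (s *: h + x) h).
  by move=> s01; apply: is_derive_along_line; exact: df.
have dgo (s : R) : s \in `]0, 1[%R ->
    is_derive s (1 : R) (fun t => f (t *: h + x)) ('d f (s *: h + x) h).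
  by rewrite in_itv /= => /andP[s0 s1]; apply: dg; rewrite !ltW.
have cg : {within `[0, 1], continuous (fun t => f (t *: h + x))}.
  apply: continuous_in_subspaceT => s; rewrite inE /= in_itv /= => s01.
  by apply: differentiable_continuous; apply/derivable1_diffP; have [] := dg s s01.
have [c] := MVT_segment ler01 dgo cg.
rewrite in_itv /= scale1r scale0r add0r subr0 mulr1 => c01 ->; exact: fB.
Qed.

Lemma Rintegral_dominated_cvg d (T : measurableType d) (R : realType)
    (mu : {measure set T -> \bar R}) (D : set T) (f_ : nat -> T -> R)
    (f g : T -> R) :
  measurable D -> (forall k, measurable_fun D (f_ k)) ->
  (forall t, D t -> f_ k t @[k --> \oo] --> f t) ->
  mu.-integrable D (EFin \o g) ->
  (forall k t, D t -> `|f_ k t| <= g t) ->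
  mu.-integrable D (EFin \o f) /\
  Rintegral mu D (f_ k) @[k --> \oo] --> Rintegral mu D f.
Proof.
move=> mD mf ff ig fg.
have mfl : measurable_fun D f by exact: measurable_fun_cvg mf ff.
have [] := @dominated_convergence _ _ _ mu D mD (fun k => EFin \o f_ k)
    (EFin \o f) (EFin \o g).
- by move=> k; exact/measurable_EFinP.
- exact/measurable_EFinP.
- by apply/aeW => t Dt; apply: cvg_EFin; [exact: nearW|exact: ff].
- exact: ig.
- by apply/aeW => t k Dt; rewrite lee_fin; exact: fg.
move=> fi _ If; split => //; apply: fine_cvg.
by rewrite fineK //; exact: integrable_fin_num.
Qed.

Section differentiation_under_integral.
Variables (R : realType) (V : normedModType R).
Variables (d : measure_display) (T : measurableType d).
Variables (mu : {measure set T -> \bar R}) (D : set T).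
Variables (u : T -> V -> R) (U : set V).
Hypotheses (mD : measurable D)
  (du : forall t x, D t -> U x -> differentiable (u t) x)
  (cdu : forall t v x, D t -> U x -> {for x, continuous (fun y => 'd (u t) y v)})
  (iu : forall x, mu.-integrable D (fun t => (u t x)%:E))
  (dom : forall x0, U x0 -> exists g : T -> R, exists r : R,
    [/\ mu.-integrable D (EFin \o g), 0 < r, ball x0 r `<=` U &
      forall t x v, D t -> ball x0 r x -> `|'d (u t) x v| <= g t * `|v|]).

Let L x v := Rintegral mu D (fun t => 'd (u t) x v).

Let mu_fun x : measurable_fun D (u ^~ x).
Proof. by have /integrableP[/measurable_EFinP] := iu x. Qed.

(** The difference quotients in direction [v] with steps 1/(k+1) are measurable in [t] and converge
    pointwise to the differential. The steps never vanish, so they do approach 0 in the punctured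
    sense of a derivative. *)
Let mdu x v : U x -> measurable_fun D (fun t => 'd (u t) x v).
Proof.
move=> Ux; pose q k : T -> R :=
  fun t => k.+1%:R *: (u t (k.+1%:R^-1 *: v + x) - u t x).
apply: (@measurable_fun_cvg _ _ _ D q).
  by move=> k; apply: measurable_funM => //; exact: measurable_funB.
move=> t Dt.
have dv := diff_derivable (v := v) (du Dt Ux).
rewrite -deriveE; last exact: du.
have := dv; rewrite /derivable => dvc.
have h0 : k.+1%:R^-1 @[k --> \oo] --> (0 : R)^'.
  have h00 : k.+1%:R^-1 @[k --> \oo] --> (0 : R) by exact: cvg_harmonic.
  move=> A /h00 hA.
  have : \forall k \near \oo, k.+1%:R^-1 != 0 :> R -> A k.+1%:R^-1 by exact: hA.
  by apply: filterS => k; apply; rewrite invr_neq0.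
have := cvg_comp _ _ h0 dvc; apply: cvg_trans; apply: near_eq_cvg.
by apply: nearW => k /=; rewrite /q invrK.
Qed.

Let idu x v : U x -> mu.-integrable D (EFin \o (fun t => 'd (u t) x v)).
Proof.
move=> Ux; have [g [r [ig r0 _ bg]]] := dom Ux.
apply: (@le_integrable _ _ _ mu D _ _ (fun t => `|v|%:E * (g t)%:E)%E) => //.
- by apply/measurable_EFinP; exact: mdu.
- move=> t Dt; rewrite lee_fin mulrC (le_trans (bg t x v Dt (ballxx _ r0))) //.
  exact: ler_norm.
- exact: integrableZl.
Qed.

(** Dominated convergence along sequences in the ball around [x0], with majorant g(t) |v|. *)
Let cvgL x0 v e : U x0 -> 0 < e -> \forall x \near x0, `|L x0 v - L x v| <= e.
Proof.
move=> Ux0 e0; have [g [r [ig r0 rU bg]]] := dom Ux0.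
have H := @cvg_seq_near _ V R^o (L ^~ v) (ball x0 r) x0 (L x0 v).
have : \forall x \near x0, ball x0 r x -> `|L x0 v - L x v| <= e.
  apply: H => // y yr yx0.
  apply: (proj2 (@Rintegral_dominated_cvg _ _ _ _ _ _ _
    (fun t => g t * `|v|) _ _ _ _ _)) => //.
  - by move=> k; apply: mdu; exact/rU/yr.
  - move=> t Dt; exact: (cvg_comp _ _ yx0 (@cdu t v x0 Dt Ux0)).
  - by have := integrableZr mD `|v| ig; apply: eq_integrable.
  - by move=> k t Dt; apply: bg.
by apply: filterS2 (nbhsx_ballx x0 r r0) => x xr; exact.
Qed.

Let L_linear x : U x -> linear (L x).
Proof.
move=> Ux a v w; rewrite -[RHS]/(a * L x v + L x w).
rewrite /L -RintegralZl ?idu // -RintegralD ?idu //.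
  by apply: eq_Rintegral => t _; rewrite linearP.
exact: (integrableZl mD a (idu v Ux)).
Qed.

Let F x := Rintegral mu D (u ^~ x).

(** No smallness of [v] is asked: this is why [iu] is stated at all points, also outside [U]. *)
Let increment x0 v : U x0 ->
  F (v + x0) - F x0 - L x0 v =
  Rintegral mu D (fun t => u t (v + x0) - u t x0 - 'd (u t) x0 v).
Proof.
move=> Ux0; rewrite RintegralB //; last exact: idu.
- by congr (_ - _); rewrite RintegralB //; exact: iu.
- exact: (integrableB mD (iu (v + x0)) (iu x0)).
Qed.

(** The first-order remainder divided by |h| is the integral of a function that tends to 0
    pointwise. It is dominated by 2g: one [g] bounds the increment, by the mean value inequality,
    and the other bounds the differential. *)
Let diffF x0 : U x0 -> differentiable F x0 /\ 'd F x0 = L x0 :> (V -> R).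
Proof.
move=> Ux0; have [g [r [ig r0 rU bg]]] := dom Ux0.
pose Llin := GRing.isLinear.Build _ _ _ _ _ (L_linear Ux0).
pose Lx0 : {linear V -> R} := HB.pack (L x0) Llin.
pose G := Rintegral mu D g.
have LG h : `|L x0 h| <= G * `|h|.
  have gh : mu.-integrable D (EFin \o (fun t => g t * `|h|)).
    exact: (integrableZr mD `|h| ig).
  rewrite /G -RintegralZr //; apply: le_trans (le_normr_Rintegral mD (idu h Ux0)) _.
  apply: le_Rintegral => //; first exact: integrable_norm (idu h Ux0).
  by move=> t Dt; apply: bg => //; exact: ballxx.
have Lc : continuous Lx0.
  move=> v; apply/cvgrPdist_le => e e0.
  have G0 : 0 < `|G| + 1 by rewrite ltr_wpDl.
  near=> w; rewrite -linearB; apply: le_trans (LG _) _.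
  apply: (@le_trans _ _ ((`|G| + 1) * `|v - w|)).
    by rewrite ler_wpM2r // (le_trans (ler_norm _)) // lerDl.
  rewrite -ler_pdivlMl // mulrC; near: w; apply: cvgr_dist_le => //.
  by rewrite divr_gt0.
have FL : F \o shift x0 = cst (F x0) + Lx0 +o_ 0 id.
  apply/eqaddoP => e e0.
  (* Division by the norm requires [h != 0]; the value h = 0 is treated separately below. The ball
     condition keeps the segment from [x0] to [h + x0] where [g] dominates. *)
  pose P : set V := [set h | h != 0 /\ ball 0 r h].
  pose Q h := (F (h + x0) - F x0 - L x0 h) * `|h|^-1.
  have H : \forall h \near (0 : V), P h -> `|0 - Q h| <= e.
    apply: (@cvg_seq_near _ V R^o Q P 0 0) => // y yP y0.
    pose f_ k t := (u t (y k + x0) - u t x0 - 'd (u t) x0 (y k)) * `|y k|^-1.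
    have QE k : Q (y k) = Rintegral mu D (f_ k).
      rewrite /Q increment // -RintegralZr //.
      have := integrableB mD (integrableB mD (iu (y k + x0)) (iu x0)) (idu (y k) Ux0).
      by apply: eq_integrable.
    have -> : 0 = Rintegral mu D (cst 0) by rewrite Rintegral_cst // mul0r.
    under eq_fun do rewrite QE.
    apply: (proj2 (@Rintegral_dominated_cvg _ _ _ _ _ _ _
      (fun t => g t + g t) _ _ _ _ _)) => //.
    - move=> k; apply: measurable_funM => //; apply: measurable_funB; last exact: mdu.
      exact: measurable_funB.
    - move=> t Dt; apply/cvgrPdist_le => d0 d00; rewrite /f_.
      have /eqaddoP/(_ _ d00) := diff_locally (du Dt Ux0).
      move=> /y0 hy; have hy' : \forall k \near \oo,
          `|u t (y k + x0) - u t x0 - 'd (u t) x0 (y k)| <= d0 * `|y k|.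
        have hyk : \forall k \near \oo,
              `|(u t \o shift x0 - (cst (u t x0) + 'd (u t) x0)) (y k)| <=
              d0 * `|y k| := hy.
          by move: hyk; apply: filterS => k; rewrite !fctE /= opprD addrA.
      move: hy'; apply: filterS => k hk.
      rewrite sub0r normrN normrM normfV normr_id ler_pdivrMr //.
      by rewrite normr_gt0; case: (yP k).
    - exact: (integrableD mD ig ig).
    - move=> k t Dt; have [yk0 ykr] := yP k.
      rewrite normrM normfV normr_id ler_pdivrMr ?normr_gt0 // mulrDl.
      have sr (s : R) : 0 <= s <= 1 -> ball x0 r (s *: y k + x0).
        move=> /andP[s0 s1]; move: ykr; rewrite -!ball_normE /= sub0r normrN => ykr.
        rewrite opprD addrCA subrr addr0 normrN normrZ ger0_norm //.
        by apply: le_lt_trans ykr; rewrite ler_piMl.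
      rewrite (le_trans (ler_normB _ _)) // lerD //.
        apply: mean_value_bound => s s01; first by apply: du => //; exact/rU/sr.
        by apply: bg => //; exact: sr.
      by apply: bg => //; exact: ballxx.
  have rb := nbhsx_ballx (0 : V) r r0.
  near=> h.
  have E : (F \o shift x0 - (cst (F x0) + Lx0)) h = F (h + x0) - F x0 - L x0 h.
    by rewrite !fctE opprD addrA.
  rewrite E; have [->|h0] := eqVneq h 0.
    have -> : L x0 0 = 0 by exact: (linear0 Lx0).
    by rewrite add0r subrr sub0r normrN !normr0 mulr0.
  have : P h -> `|0 - Q h| <= e by near: h.
  have hr : ball 0 r h by near: h.
  move=> /(_ (conj h0 hr)).
  by rewrite sub0r normrN normrM normfV normr_id ler_pdivrMr // normr_gt0.
have dE : 'd F x0 = L x0 :> (V -> R) by exact: diff_unique Lc FL.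
split=> //; apply/diff_locallyP; rewrite dE; split; first exact: Lc.
exact: FL.
Unshelve. all: by end_near. Qed.

(** Domination is only local in [x0], because in a chart the comparison between the metric and the
    coordinate norm is only locally uniform. *)
Theorem Ck1_Rintegral : Ck 1 U F.
Proof.
split=> [x Ux|v x Ux]; first by have [] := diffF Ux.
apply/cvgrPdist_le => e e0; have [_ ->] := diffF Ux.
have [g [r [_ r0 rU _]]] := dom Ux.
near=> y.
have Uy : U y by apply: rU; near: y; exact: nbhsx_ballx.
have [_ ->] := diffF Uy; near: y; exact: cvgL.
Unshelve. all: by end_near. Qed.

End differentiation_under_integral.

(** * The chain rule in charts and through tangent spaces *)

Lemma near_eq_diff (R : realType) (V W : normedModType R) (f g : V -> W) (x : V) :
  (\forall y \near x, f y = g y) -> differentiable f x ->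
  differentiable g x /\ 'd g x = 'd f x :> (V -> W).
Proof.
move=> fg df.
have gL : g \o shift x = cst (g x) + 'd f x +o_ 0 id.
  have fgx : f x = g x by exact: nbhs_singleton fg.
  have := diff_locally df; move=> /eqaddoP fL; apply/eqaddoP => e e0.
  have sh : \forall h \near (0 : V), f (h + x) = g (h + x).
    rewrite (near_shift x) /=; apply: filterS fg => y /=.
    by rewrite sub0r addrNK.
  by apply: filterS2 sh (fL e e0) => h fgh; rewrite !fctE /= fgh fgx.
have dE : 'd g x = 'd f x :> (V -> W).
  by apply: diff_unique gL; exact: diff_continuous.
split=> //; apply/diff_locallyP; rewrite dE; split=> //.
exact: diff_continuous.
Unshelve. all: by end_near. Qed.

Lemma near_eq_continuous_at (T U : topologicalType) (f h : T -> U) (x : T) :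
  (\forall y \near x, f y = h y) -> {for x, continuous f} -> {for x, continuous h}.
Proof.
move=> fh; rewrite /prop_for /continuous_at -(nbhs_singleton fh).
by apply: cvg_trans; exact: near_eq_cvg fh.
Qed.

(** [Ck 1] gives continuity of the differential at each fixed vector only. Expanding the moving
    vector [y z] in the standard basis reduces to finitely many fixed vectors. *)
Lemma continuous_diff_apply (R : realType) (n : nat) (V : normedModType R)
    (f : 'cV[R]_n -> R) (U : set 'cV[R]_n) (q y : V -> 'cV[R]_n) (x : V) :
  Ck 1 U f -> U (q x) -> {for x, continuous q} -> {for x, continuous y} ->
  {for x, continuous (fun z => 'd f (q z) (y z))}.
Proof.
move=> [_ fU] Uq cq cy.
have E z : 'd f (q z) (y z) =
    \sum_(i < n) y z i 0 * 'd f (q z) (delta_mx i 0).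
  rewrite [X in 'd f (q z) X](matrix_sum_delta (y z)) linear_sum.
  apply: eq_bigr => i _; rewrite big_ord1 linearZ /=.
  by congr (_ * _); congr ('d f (q z) (delta_mx i _)); rewrite ord1.
rewrite (funext E) /=; apply: cvg_big => [|i _]; first exact: add_continuous.
apply: cvgM.
  exact: (cvg_comp _ _ cy (@coord_continuous _ _ _ i 0 (y x))).
exact: (cvg_comp _ _ cq (fU (delta_mx i 0) _ Uq)).
Qed.

Lemma Csmooth_Ck1 (R : realType) (V W : normedModType R) (U : set V) (f : V -> W) :
  Csmooth U f -> Ck 1 U f.
Proof. by move=> /(_ 1%N). Qed.

Section chain_rule.
Variables (R : realType) (n : nat) (M : topologicalType).
Variable X : smooth_manifold R n M.

Lemma C1_fun_continuous (W : normedModType R) (f : M -> W) :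
  C1_fun X f -> continuous f.
Proof.
move=> Cf m; pose a := chart_at X m.
have am : chart_dom a m := chart_at_dom X m.
have [df _] := Cf a (chart_at_atlas X m).
have := differentiable_continuous (df (a m) (ex_intro2 _ _ m am erefl)).
move=> cfa; have := cvg_comp _ _ (chart_fun_continuous am) cfa.
rewrite /= (chart_funK am); apply: cvg_trans; apply: near_eq_cvg.
have : \forall m' \near m, chart_dom a m'.
  exact: open_nbhs_nbhs (conj (chart_dom_open a) am).
by apply: filterS => m' am' /=; rewrite chart_funK.
Qed.

Variables (omega : M -> R) (p : M -> M).
Hypotheses (Comega : C1_fun X omega) (Cp : C1_map X p).
Variable (c : chart R n M).
Hypothesis (Xc : atlas X c).

Let U := c @` chart_dom c.

Let near_dom (A : set M) (x : 'cV[R]_n) : open A -> U x -> A (chart_inv c x) ->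
  \forall y \near x, A (chart_inv c y).
Proof.
move=> oA Ux Ax; apply: (chart_inv_continuous Ux).
exact: open_nbhs_nbhs.
Qed.

Let dom_inv x : U x -> chart_dom c (chart_inv c x) /\ c (chart_inv c x) = x.
Proof. by move=> [m cm <-]; rewrite chart_funK. Qed.

Let nearU x : U x -> \forall y \near x, U y.
Proof. by move=> Ux; apply: open_nbhs_nbhs; split=> //; exact: chart_img_open. Qed.

Let open_pre (A : set M) : open A -> open (p @^-1` A).
Proof. by move=> oA; have [cp _] := Cp; apply: open_comp => // x _; exact: cp. Qed.

(** The target chart [b] is arbitrary, not [chart_at] of the image point, so that it can stay fixed
    while [x] varies; continuity of the differential requires this. *)
Lemma diff_comp_C1_map (b : chart R n M) (x : 'cV[R]_n) :
  atlas X b -> U x -> chart_dom b (p (chart_inv c x)) ->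
  differentiable (omega \o p \o chart_inv c) x /\
  forall v, 'd (omega \o p \o chart_inv c) x v =
    'd (omega \o chart_inv b) (b (p (chart_inv c x)))
      ('d (b \o p \o chart_inv c) x v).
Proof.
move=> Xb Ux bx; have [cx cxK] := dom_inv Ux.
have [dq _] := (proj2 Cp) c b Xc Xb.
have [dW _] := Comega Xb.
have dqx : differentiable (b \o p \o chart_inv c) x.
  by apply: dq; exists (chart_inv c x).
have dWx : differentiable (omega \o chart_inv b) ((b \o p \o chart_inv c) x).
  by apply: dW; exists (p (chart_inv c x)).
(* [chart_inv b] undoes [b] only on the domain of [b], so the two expressions agree only near [x];
   differentials being local, this is enough. *)
have near_eq : \forall y \near x,
    ((omega \o chart_inv b) \o (b \o p \o chart_inv c)) y =
    (omega \o p \o chart_inv c) y.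
  have : \forall y \near x, (p @^-1` chart_dom b) (chart_inv c y).
    by apply: near_dom => //; apply: open_pre; exact: chart_dom_open.
  by apply: filterS => y py /=; rewrite chart_funK.
have [dx dE] := near_eq_diff near_eq (differentiable_comp dqx dWx).
split=> // v; have dcomp := diff_comp dqx dWx.
exact: (etrans (congr1 (@^~ v) dE) (congr1 (@^~ v) dcomp)).
Qed.

Lemma Ck1_comp_C1_map : Ck 1 U (omega \o p \o chart_inv c).
Proof.
split=> [x Ux|v x Ux].
  by have [] := diff_comp_C1_map (chart_at_atlas X _) Ux (chart_at_dom X _).
pose b := chart_at X (p (chart_inv c x)).
have Xb : atlas X b := chart_at_atlas X _.
have bx : chart_dom b (p (chart_inv c x)) := chart_at_dom X _.
have [cx cxK] := dom_inv Ux.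
have [dq cdq] := (proj2 Cp) c b Xc Xb.
have qx : (c @` (chart_dom c `&` p @^-1` chart_dom b)) x by exists (chart_inv c x).
have H : {for x, continuous (fun z => 'd (omega \o chart_inv b)
    ((b \o p \o chart_inv c) z) ('d (b \o p \o chart_inv c) z v))}.
  apply: (continuous_diff_apply (Comega Xb)).
  - by exists (p (chart_inv c x)).
  - exact: differentiable_continuous (dq _ qx).
  - exact: cdq.
have px : \forall y \near x, (p @^-1` chart_dom b) (chart_inv c y).
  by apply: near_dom => //; apply: open_pre; exact: chart_dom_open.
apply: near_eq_continuous_at H; apply: filterS2 px (nearU Ux) => y py Uy.
by have [_ dE] := diff_comp_C1_map Xb Uy py; exact: (esym (dE v)).
Qed.

(** The norm bounds concern tangent spaces, whose coordinates come from [chart_at]. The transition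
    from [c] to the chart at the base point has differential [of_chart], and the chain rule does the
    rest. *)
Lemma diff_comp_tangent_map (x v : 'cV[R]_n) : U x ->
  'd (omega \o p \o chart_inv c) x v =
  tangent_fun X omega (tangent_map X p (of_chart X c x v)).
Proof.
move=> Ux; have [cx cxK] := dom_inv Ux.
pose m := chart_inv c x; pose a := chart_at X m; pose b := chart_at X (p m).
have Xa : atlas X a := chart_at_atlas X _.
have Xb : atlas X b := chart_at_atlas X _.
have am : chart_dom a m := chart_at_dom X _.
have bm : chart_dom b (p m) := chart_at_dom X _.
have [_ dE] := diff_comp_C1_map Xb Ux bm; rewrite dE.
rewrite /= /tangent_fun /tangent_map -/m -/a -/b /of_chart -/m -/a.
congr ('d (omega \o chart_inv b) (b (p m)) _).
have [dac _] := Csmooth_Ck1 (atlas_smooth Xc Xa).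
have dacx : differentiable (a \o chart_inv c) x by apply: dac; exists m.
have [dq _] := (proj2 Cp) a b Xa Xb.
have dqx : differentiable (b \o p \o chart_inv a) ((a \o chart_inv c) x).
  by apply: dq; exists m.
have near_eq : \forall y \near x,
    ((b \o p \o chart_inv a) \o (a \o chart_inv c)) y =
    (b \o p \o chart_inv c) y.
  have : \forall y \near x, chart_dom a (chart_inv c y).
    by apply: near_dom => //; exact: chart_dom_open.
  by apply: filterS => y ay /=; rewrite chart_funK.
have [_ dqE] := near_eq_diff near_eq (differentiable_comp dacx dqx).
have dcomp := diff_comp dacx dqx.
exact: (etrans (congr1 (@^~ v) dqE) (congr1 (@^~ v) dcomp)).
Qed.

End chain_rule.

(** * Bounds in the Riemannian metric *)

Lemma bformZ (R : realType) (n : nat) (A : 'M[R]_n) (a : R) (x : 'cV[R]_n) :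
  bform A (a *: x) (a *: x) = a ^+ 2 * bform A x x.
Proof.
by rewrite /bform -scalemxAr linearZ /= -!scalemxAl !mxE expr2 mulrA.
Qed.

Lemma bform_lincomb (R : realType) (n : nat) (A : 'M[R]_n) (I : finType)
    (a : I -> R) (e : I -> 'cV[R]_n) :
  bform A (\sum_i a i *: e i) (\sum_i a i *: e i) =
  \sum_i \sum_j a i * a j * bform A (e i) (e j).
Proof.
rewrite /bform [(\sum_i _)^T]linear_sum /= !mulmx_suml summxE.
apply: eq_bigr => i _; rewrite mulmx_sumr summxE; apply: eq_bigr => j _.
by rewrite -scalemxAr linearZ /= -!scalemxAl !mxE mulrCA mulrA.
Qed.

Section metric_bounds.
Variables (R : realType) (n : nat) (M : topologicalType).
Variables (X : smooth_manifold R n M) (g : riemannian_metric X).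

Lemma metric_normZ (m : M) (a : R) (v : 'cV[R]_n) :
  @metric_norm _ _ _ _ g m (a *: v) = `|a| * @metric_norm _ _ _ _ g m v.
Proof. by rewrite /metric_norm bformZ sqrtrM ?sqr_ge0 // sqrtr_sqr. Qed.

Lemma metric_norm_gt0 (m : M) (v : 'cV[R]_n) :
  v != 0 -> 0 < @metric_norm _ _ _ _ g m v.
Proof. by move=> v0; rewrite sqrtr_gt0; apply: (metric_sym_posdef g m).2. Qed.

(** A nonzero [v] is scaled to unit length, which puts it in the set of the supremum; absolute
    homogeneity of [q] scales back. *)
Lemma op_norm_bound (W : lmodType R) (q : W -> R) (m : M)
    (T : {linear 'cV[R]_n -> W}) (b : R) (v : 'cV[R]_n) :
  (forall a w, q (a *: w) = `|a| * q w) ->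
  (op_norm (@metric_norm _ _ _ _ g m) q T <= b%:E)%E ->
  q (T v) <= b * @metric_norm _ _ _ _ g m v.
Proof.
move=> qZ Tb; have [->|v0] := eqVneq v 0.
  (* At the zero vector both sides vanish by homogeneity alone, once 0 is written as 0 times a
     vector. *)
  have T0 : T 0 = 0 *: T 0 by rewrite -linearZ scaler0.
  have z0 : (0 : 'cV[R]_n) = 0 *: 0 by rewrite scaler0.
  by rewrite T0 [in leRHS]z0 qZ metric_normZ normr0 !mul0r mulr0.
have nv := metric_norm_gt0 m v0; set k := metric_norm _ _ in nv *.
rewrite -ler_pdivrMr // mulrC -(gtr0_norm (_ : 0 < k^-1)) ?invr_gt0 // -qZ -linearZ.
rewrite -lee_fin; apply: le_trans Tb; apply: ereal_sup_ubound.
exists (k^-1 *: v) => //=.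
by rewrite metric_normZ gtr0_norm ?invr_gt0 // mulVf // lt0r_neq0.
Qed.

(** The finitely many Gram entries in the chart are continuous, so near [x0] each exceeds its
    absolute value at [x0] by at most 1. Expanding [v] in the basis bounds the quadratic form by the
    sum of these bounds times |v|^2. *)
Lemma metric_norm_of_chart_bound (c : chart R n M) (x0 : 'cV[R]_n) :
  atlas X c -> (c @` chart_dom c) x0 -> exists b : R, 0 <= b /\
  \forall x \near x0, forall v, metric_norm g (of_chart X c x v) <= b * `|v|.
Proof.
move=> Xc Ux0.
pose B i j x := bform (metric_gram g (chart_inv c x))
  (of_chart X c x (delta_mx i 0)) (of_chart X c x (delta_mx j 0)).
pose b := \sum_i \sum_j (`|B i j x0| + 1).
have b0 : 0 <= b by apply: sumr_ge0 => i _; apply: sumr_ge0 => j _; rewrite addr_ge0.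
exists (Num.sqrt b); split; first exact: sqrtr_ge0.
have nearB : \forall x \near x0, forall ij : 'I_n * 'I_n,
    `|B ij.1 ij.2 x| <= `|B ij.1 ij.2 x0| + 1.
  apply: (@filter_forall _ _ _ _ (nbhs_filter x0)) => -[i j] /=.
  have cB : {for x0, continuous (B i j)}.
    exact: (metric_smooth g Xc (delta_mx i 0) (delta_mx j 0) 0%N _ Ux0).
  move/cvgrPdist_le : cB => /(_ 1 ltr01); apply: filterS => x hx.
  rewrite -(subrK (B i j x0) (B i j x)) addrC (le_trans (ler_normD _ _)) // lerD2l.
  by rewrite distrC.
move: nearB; apply: filterS => x hx v.
have vn i : `|v i 0| <= `|v|.
  by rewrite [leRHS]/Num.Def.normr /= mx_normrE; exact: (le_bigmax _ _ (i, 0)).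
have vE : of_chart X c x v = \sum_i v i 0 *: of_chart X c x (delta_mx i 0).
  rewrite {1}(matrix_sum_delta v) /of_chart linear_sum; apply: eq_bigr => i _.
  by rewrite big_ord1 linearZ.
have -> : Num.sqrt b * `|v| = Num.sqrt (b * `|v| ^+ 2).
  by rewrite sqrtrM // sqrtr_sqr normr_id.
rewrite /metric_norm ler_wsqrtr // vE bform_lincomb mulr_suml.
apply: ler_sum => i _; rewrite mulr_suml; apply: ler_sum => j _.
apply: le_trans (ler_norm _) _; rewrite normrM mulrC ler_pM //.
  exact: (hx (i, j)).
by rewrite normrM expr2 ler_pM.
Qed.

End metric_bounds.

(** * Matrix exponential and smallest eigenvalue *)

Lemma spectral_powers (R : comNzRingType) (N : nat) (A : 'M[R]_N)
    (P : 'I_N -> 'M[R]_N) (d : 'I_N -> R) (a : R) (k : nat) :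
  \sum_l P l = 1%:M -> (forall l, A *m P l = d l *: P l) ->
  (a *: A) ^+ k = \sum_l (a * d l) ^+ k *: P l.
Proof.
move=> P1 AP; elim: k => [|k IH].
  by rewrite expr0 -[LHS]P1; apply: eq_bigr => l _; rewrite expr0 scale1r.
rewrite exprS IH mulr_sumr; apply: eq_bigr => l _.
rewrite -mulmxE -scalemxAr -scalemxAl AP !scalerA exprS.
by congr (_ *: _); ring.
Qed.

Lemma expmx_spectral (R : realType) (N : nat) (A : 'M[R]_N)
    (P : 'I_N -> 'M[R]_N) (d : 'I_N -> R) (t : R) :
  \sum_l P l = 1%:M -> (forall l, A *m P l = d l *: P l) ->
  expmx (- (t *: A)) = \sum_l expR (- (d l * t)) *: P l.
Proof.
move=> P1 AP; rewrite /expmx -scaleNr; apply: cvg_lim; first exact: norm_hausdorff.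
have -> : series (fun k => (k`!%:R)^-1 *: (- t *: A) ^+ k) =
    fun n => \sum_l (series (exp_coeff (- (d l * t))) n) *: P l.
  apply/funext => n; rewrite /series /=.
  under eq_bigr do rewrite (spectral_powers _ _ P1 AP) scaler_sumr.
  rewrite exchange_big; apply: eq_bigr => l _ /=.
  rewrite scaler_suml; apply: eq_bigr => k _; rewrite scalerA /exp_coeff /=.
  by congr (_ *: _); rewrite mulrC mulNr [t * _]mulrC.
apply: cvg_big => [|l _]; first exact: add_continuous.
by apply: cvgZr_tmp; exact: is_cvg_series_exp_coeff.
Qed.

(** A row eigenvector satisfies v A v^T = a v v^T with v v^T >= 0, so a <= 0 would contradict
    positive definiteness. *)
Lemma posdef_eigenvalue_gt0 (R : realType) (N : nat) (A : 'M[R]_N) (a : R) :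
  sym_posdef A -> eigenvalue A a -> 0 < a.
Proof.
move=> [Asym Apos] /eigenvalueP[v vA v0].
have vT0 : v^T != 0 by apply: contra_neq v0 => vT; rewrite -[v]trmxK vT trmx0.
have := Apos _ vT0; rewrite /bform trmxK vA -scalemxAl mxE.
have vv : 0 <= (v *m v^T) 0 0.
  by rewrite mxE sumr_ge0 // => i _; rewrite mxE -expr2 sqr_ge0.
by apply: contraTT; rewrite -!leNgt => a0; rewrite mulr_le0_ge0.
Qed.

Lemma min_eigenvalue_le (R : realType) (N : nat) (A : 'M[R]_N) (a : R) :
  sym_posdef A -> eigenvalue A a -> min_eigenvalue A <= a.
Proof.
move=> Ap Aa; apply: ge_inf => //; exists 0 => b /= Ab.
exact/ltW/(posdef_eigenvalue_gt0 Ap).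
Qed.

(** Every eigenvalue is some [d l]: the [P l] sum to 1, so a row eigenvector [v] has v P_l nonzero
    for some l, and (a - d_l) v P_l = 0. Hence the least [d l] bounds the infimum below. For N = 0
    the infimum would be that of the empty set, which is 0 by default. *)
Lemma min_eigenvalue_gt0 (R : realType) (N : nat) (A : 'M[R]_N)
    (P : 'I_N -> 'M[R]_N) (d : 'I_N -> R) :
  (0 < N)%N -> sym_posdef A -> \sum_l P l = 1%:M ->
  (forall l, A *m P l = d l *: P l) -> (forall l, eigenvalue A (d l)) ->
  0 < min_eigenvalue A.
Proof.
move=> N0 Ap P1 AP Ad; pose l0 := Ordinal N0.
pose l1 := [arg min_(l < l0) d l]%O.
have d1 l : d l1 <= d l by rewrite /l1; case: arg_minP => //= i _; apply.
apply: lt_le_trans (posdef_eigenvalue_gt0 Ap (Ad l1)) _.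
apply: lb_le_inf; first by exists (d l0) => /=.
move=> a /= /eigenvalueP[v vA v0].
have [l /eqP vPl] : exists l, v *m P l != 0.
  apply: contrapT => nP; move/eqP: v0; apply.
  rewrite -[v]mulmx1 -P1 mulmx_sumr big1 // => l _.
  by apply/eqP; apply: contrapT => h; apply: nP; exists l; apply/negP.
have : (a - d l) *: (v *m P l) = 0.
  by rewrite scalerBl scalemxAl -vA -mulmxA AP -scalemxAr subrr.
by move/eqP; rewrite scaler_eq0 subr_eq0 => /orP[/eqP->//|/eqP].
Qed.

(** * The synchronisation as an attracting solution of the reservoir equation *)

Lemma is_derive_scalel (R : realType) (W : normedModType R) (h : R -> R) (t dh : R)
    (w : W) :
  is_derive t (1 : R) h dh -> is_derive t (1 : R) (fun s => h s *: w) (dh *: w).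
Proof.
move=> [hd hE].
have hdf : differentiable h t by exact/derivable1_diffP.
have hwd := differentiableZl w hdf.
apply: DeriveDef; first exact: diff_derivable.
by rewrite deriveE // (diffZl w hdf) /= -deriveE // hE.
Qed.

Lemma is_derive_mulmx_coord (R : realType) (m n : nat) (B : 'M[R]_(m, n))
    (u : R -> 'cV[R]_n) (du : 'cV[R]_n) (t : R) (i : 'I_m) :
  is_derive t (1 : R) u du ->
  is_derive t (1 : R) (fun s => (B *m u s) i 0) ((B *m du) i 0).
Proof.
move=> [ud uE].
have uj j : is_derive t (1 : R) (fun s => u s j 0) (du j 0).
  apply: DeriveDef; first exact: (proj1 (derivable_mxP _ _ _) ud).
  by rewrite -uE derive_mx // mxE.
have -> : (fun s => (B *m u s) i 0) = \sum_(j < n) (fun s => B i j *: u s j 0).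
  by apply/funext => s; rewrite mxE fct_sumE.
rewrite mxE; apply: is_derive_sum => j; exact: is_deriveZ.
Qed.

Lemma linear_decay (R : realType) (a : R) (y : R -> R) :
  (forall t, is_derive t (1 : R) y (- (a * y t))) ->
  forall t, y t = expR (- (a * t)) * y 0.
Proof.
move=> dy t; pose z s := expR (a * s) * y s.
have dz s : is_derive s (1 : R) z 0.
  have dE := is_derive_expR_linear a s.
  by apply: is_derive_eq; rewrite /GRing.scale /=; ring.
have := is_derive_0_is_cst t 0 dz; rewrite /z mulr0 expR0 mul1r => <-.
by rewrite mulrA -expRD addrC subrr expR0 mul1r.
Qed.

Section synchronisation.
Variables (R : realType) (N : nat) (M : Type) (phi : R -> M -> M) (omega : M -> R).
Variables (A : 'M[R]_N) (C : 'cV[R]_N) (P : 'I_N -> 'M[R]_N) (d : 'I_N -> R) (b : R).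
Hypotheses (P1 : \sum_l P l = 1%:M) (AP : forall l, A *m P l = d l *: P l)
  (PA : forall l, P l *m A = d l *: P l) (d0 : forall l, 0 < d l).
Hypotheses (phi0 : forall m, phi 0 m = m)
  (phiD : forall s t m, phi (s + t) m = phi s (phi t m))
  (cphi : forall m, continuous (fun t => omega (phi t m)))
  (omegab : forall m, `|omega m| <= b).

(** The scalar weight h_a. *)
Definition discounted_average (a : R) (m : M) : R :=
  Rintegral (@lebesgue_measure R) `[0, +oo[
    (fun x => expR (- (a * x)) * omega (phi (- x) m)).

Lemma integrable_discounted (a : R) (m : M) : 0 < a ->
  (@lebesgue_measure R).-integrable `[0, +oo[
    (EFin \o (fun x => expR (- (a * x)) * omega (phi (- x) m))).
Proof.
move=> a0.
have := @integrable_exponential_convolution R a b (fun s => omega (phi s m)) a0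
  (@cphi m) (fun s => omegab _) 0.
by apply: eq_integrable => // x _ /=; rewrite sub0r.
Qed.

Lemma sync_integrand_spectral (m : M) (x : R) (i : 'I_N) :
  sync_integrand phi omega A C m x i 0 =
  \sum_l (P l *m C) i 0 * (expR (- (d l * x)) * omega (phi (- x) m)).
Proof.
rewrite /sync_integrand (expmx_spectral _ P1 AP) mulmx_suml summxE.
by apply: eq_bigr => l _; rewrite -scalemxAl -scalemxAr !mxE; ring.
Qed.

Lemma integrable_sync_integrand (m : M) (i : 'I_N) :
  (@lebesgue_measure R).-integrable `[0, +oo[
    (EFin \o (fun x => sync_integrand phi omega A C m x i 0)).
Proof.
have H : (@lebesgue_measure R).-integrable `[0, +oo[ (fun x =>
    \sum_l ((P l *m C) i 0)%:E *
      (expR (- (d l * x)) * omega (phi (- x) m))%:E)%E.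
  apply: integrable_sum => // l _; apply: integrableZl => //.
  exact: integrable_discounted.
apply: eq_integrable H => // x _ /=.
by rewrite sync_integrand_spectral -sumEFin.
Qed.

Lemma Rintegral_lincomb (I : finType) (k : I -> R) (f : I -> R -> R)
    (D : set (measurableTypeR R)) :
  measurable D -> (forall i, (@lebesgue_measure R).-integrable D (EFin \o f i)) ->
  Rintegral (@lebesgue_measure R) D (fun x => \sum_i k i * f i x) =
  \sum_i k i * Rintegral (@lebesgue_measure R) D (f i).
Proof.
move=> mD fi.
suff H (s : seq I) : (@lebesgue_measure R).-integrable D
      (EFin \o (fun x => \sum_(i <- s) k i * f i x)) /\
    Rintegral (@lebesgue_measure R) D (fun x => \sum_(i <- s) k i * f i x) =
    \sum_(i <- s) k i * Rintegral (@lebesgue_measure R) D (f i).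
  by case: (H (index_enum I)).
elim: s => [|i s [IH1 IH2]].
  under eq_fun do rewrite big_nil; rewrite big_nil; split; first exact: integrable0.
  by rewrite Rintegral_cst // mul0r.
have ki : (@lebesgue_measure R).-integrable D (EFin \o (fun x => k i * f i x)).
  exact: (integrableZl mD (k i) (fi i)).
under eq_fun do rewrite big_cons; rewrite big_cons; split.
  exact: (integrableD mD ki IH1).
by rewrite RintegralD // IH2 RintegralZl.
Qed.

Lemma sync_map_spectral :
  sync_map phi omega A C = fun m => \sum_l discounted_average (d l) m *: (P l *m C).
Proof.
apply/funext => m; apply/matrixP => i j; rewrite (ord1 j) mxE summxE.
under eq_Rintegral do rewrite sync_integrand_spectral.
rewrite Rintegral_lincomb //; last by move=> l; exact: integrable_discounted.
by apply: eq_bigr => l _; rewrite [RHS]mxE mulrC.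
Qed.

Lemma is_derive_discounted_average (a : R) (m : M) (t : R) : 0 < a ->
  is_derive t (1 : R) (fun s => discounted_average a (phi s m))
    (omega (phi t m) - a * discounted_average a (phi t m)).
Proof.
move=> a0.
(* The group law turns the value at [phi s m] into the convolution of e^{- a x} with the signal s
   |-> omega(phi^s m). *)
have E : (fun s => discounted_average a (phi s m)) = fun s =>
    Rintegral (@lebesgue_measure R) `[0, +oo[
      (fun x => expR (- (a * x)) * omega (phi (s - x) m)).
  apply/funext => s; apply: eq_Rintegral => x _.
  by rewrite -phiD addrC.
have dH := @is_derive_exponential_convolution R a b (fun s => omega (phi s m)) a0
  (@cphi m) (fun s => omegab _) t.
have Et := congr1 (@^~ t) E; rewrite /= in Et.
by rewrite E Et.
Qed.

Lemma is_derive_sync_map (m : M) (t : R) :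
  is_derive t (1 : R) (fun s => sync_map phi omega A C (phi s m))
    (linear_reservoir A C (sync_map phi omega A C (phi t m)) (omega (phi t m))).
Proof.
rewrite sync_map_spectral.
have -> : (fun s => \sum_l discounted_average (d l) (phi s m) *: (P l *m C)) =
    \sum_l (fun s => discounted_average (d l) (phi s m) *: (P l *m C)).
  by apply/funext => s; rewrite fct_sumE.
have -> : linear_reservoir A C (\sum_l discounted_average (d l) (phi t m) *: (P l *m C))
      (omega (phi t m)) =
    \sum_l (omega (phi t m) - d l * discounted_average (d l) (phi t m)) *: (P l *m C).
  rewrite /linear_reservoir -{2}[C]mul1mx -P1 mulmx_suml scaler_sumr mulmx_sumr.
  rewrite -sumrN -big_split; apply: eq_bigr => l _ /=.
  rewrite -scalemxAr mulmxA AP -scalemxAl scalerA scalerBl addrC.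
  by rewrite [d l * _]mulrC.
apply: is_derive_sum => l; apply: is_derive_scalel.
exact: is_derive_discounted_average.
Qed.

Lemma reservoir_solution_exists (r : 'cV[R]_N) (m : M) :
  exists x, reservoir_solution phi omega (linear_reservoir A C) r m x.
Proof.
(* The synchronisation along the orbit is a particular solution; adding the homogeneous solution
   e^{- t A} v corrects its initial value to [r]. *)
pose v := r - sync_map phi omega A C m.
exists (fun t => sync_map phi omega A C (phi t m) +
  \sum_l expR (- d l * t) *: (P l *m v)); split.
  under eq_bigr do rewrite mulr0 expR0 scale1r.
  by rewrite phi0 -mulmx_suml P1 mul1mx /v addrC subrK.
move=> t; have dS := is_derive_sync_map m t.
have dE : is_derive t (1 : R) (\sum_l (fun s => expR (- d l * s) *: (P l *m v)))
    (\sum_l (- d l * expR (- d l * t)) *: (P l *m v)).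
  by apply: is_derive_sum => l; apply: is_derive_scalel; exact: is_derive_expR_linear.
have -> : (fun t => sync_map phi omega A C (phi t m) +
    \sum_l expR (- d l * t) *: (P l *m v)) =
    (fun t => sync_map phi omega A C (phi t m)) +
    \sum_l (fun s => expR (- d l * s) *: (P l *m v)).
  by apply/funext => s; rewrite fctE fct_sumE.
apply: (is_derive_eq (is_deriveD dS dE)).
rewrite /linear_reservoir mulmxDr opprD addrAC; congr (_ + _ + _).
rewrite mulmx_sumr -sumrN; apply: eq_bigr => l _.
by rewrite -scalemxAr mulmxA AP -scalemxAl scalerA -scaleNr mulNr mulrC.
Qed.

Lemma sync_map_attracts (r : 'cV[R]_N) (m : M) (x : R -> 'cV[R]_N) :
  reservoir_solution phi omega (linear_reservoir A C) r m x ->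
  enorm (sync_map phi omega A C (phi t m) - x t) @[t --> +oo] --> (0 : R).
Proof.
move=> [_ dx]; pose u t := sync_map phi omega A C (phi t m) - x t.
have du t : is_derive t (1 : R) u (- (A *m u t)).
  have dS := is_derive_sync_map m t; have dxt := dx t.
  apply: is_derive_eq; rewrite /linear_reservoir /u mulmxBr opprB.
  by rewrite opprD opprK addrACA subrr addr0 addrC.
have uE t i : u t i 0 = \sum_l expR (- (d l * t)) * (P l *m u 0) i 0.
  rewrite -[u t in LHS]mul1mx -P1 mulmx_suml summxE; apply: eq_bigr => l _.
  apply: (@linear_decay R (d l) (fun s => (P l *m u s) i 0)) => s.
  have := is_derive_mulmx_coord (P l) i (du s).
  by rewrite mulmxN mulmxA PA -scalemxAl !mxE.
have u0 i : u t i 0 @[t --> +oo] --> (0 : R).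
  under eq_fun do rewrite uE.
  have : \sum_l expR (- (d l * t)) * (P l *m u 0) i 0 @[t --> +oo] -->
      \sum_(l < N) (0 : R).
    apply: cvg_big => [|l _]; first exact: add_continuous.
    set k := (P l *m u 0) i 0.
    have H := cvgM (cvgr_expRN_linear (d0 l)) (cvg_cst k).
    by rewrite mul0r in H; exact: H.
  by rewrite big1_eq.
have sq0 : Num.sqrt z @[z --> (0 : R)] --> (0 : R).
  by have := @sqrt_continuous R 0; rewrite /continuous_at sqrtr0.
apply: (cvg_comp (fun t => \sum_i u t i 0 ^+ 2) Num.sqrt _ sq0).
have : \sum_i u t i 0 ^+ 2 @[t --> +oo] --> \sum_(i < N) (0 : R).
  apply: cvg_big => [|i _]; first exact: add_continuous.
  by have H := cvgM (u0 i) (u0 i); rewrite mulr0 in H; exact: H.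
by rewrite big1_eq.
Qed.

End synchronisation.

(** * Regularity of the weights and of the synchronisation *)

Lemma Ck1D (R : realType) (V W : normedModType R) (U : set V) (f h : V -> W) :
  open U -> Ck 1 U f -> Ck 1 U h -> Ck 1 U (f + h).
Proof.
move=> oU [df cf] [dh ch]; split=> [x Ux|v x Ux].
  by apply: differentiableD; [exact: df|exact: dh].
(* The formula for the differential of a sum is known on [U] only; openness makes it hold near [x],
   as continuity at [x] demands. *)
have nU : \forall y \near x, U y by exact: open_nbhs_nbhs.
have cfh : {for x, continuous (fun y => 'd f y v + 'd h y v)}.
  by apply: cvgD; [exact: cf|exact: ch].
apply: near_eq_continuous_at cfh; apply: filterS nU => y Uy.
exact: (esym (congr1 (@^~ v) (diffD (df y Uy) (dh y Uy)))).
Qed.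

Lemma Ck1_scalel (R : realType) (V W : normedModType R) (U : set V) (h : V -> R)
    (w : W) :
  open U -> Ck 1 U h -> Ck 1 U (fun x => h x *: w).
Proof.
move=> oU [dh ch]; split=> [x Ux|v x Ux].
  by apply: differentiableZl; exact: dh.
have nU : \forall y \near x, U y by exact: open_nbhs_nbhs.
have chw : {for x, continuous (fun y => 'd h y v *: w)}.
  by apply: cvgZr_tmp; exact: ch.
apply: near_eq_continuous_at chw; apply: filterS nU => y Uy.
exact: (esym (congr1 (@^~ v) (diffZl w (dh y Uy)))).
Qed.

Lemma Ck1_lincomb (R : realType) (V W : normedModType R) (U : set V) (I : finType)
    (h : I -> V -> R) (w : I -> W) :
  open U -> (forall i, Ck 1 U (h i)) -> Ck 1 U (fun x => \sum_i h i x *: w i).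
Proof.
move=> oU hU.
have -> : (fun x => \sum_i h i x *: w i) = \sum_i (fun x => h i x *: w i).
  by apply/funext => x; rewrite fct_sumE.
apply: big_ind => [||i _]; last exact: Ck1_scalel.
- split=> [x _|v x _]; first exact: (@differentiable_cst _ V W 0).
  have c0 : {for x, continuous (fun _ : V => 0 : W)} by exact: cst_continuous.
  apply: near_eq_continuous_at c0; apply: nearW => y.
  exact: (esym (congr1 (@^~ v) (@diff_cst _ V W 0 y))).
- by move=> f1 f2; exact: Ck1D.
Qed.

Lemma ereal_sup_bound (R : realType) (T : Type) (f : T -> \bar R) :
  (ereal_sup [set f x | x in [set: T]] < +oo)%E ->
  exists b : R, 0 <= b /\ forall x, (f x <= b%:E)%E.
Proof.
have fs x : (f x <= ereal_sup [set f x | x in [set: T]])%E.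
  by apply: ereal_sup_ubound; exists x.
case: (ereal_sup _) fs => [r fr _|_|fr _] //.
- exists `|r|; split=> // x; apply: le_trans (fr x) _.
  by rewrite lee_fin ler_norm.
(* The supremum is -oo, for instance when [T] is empty; any real bound then serves. *)
- by exists 0; split=> // x; apply: le_trans (fr x) _; rewrite leNye.
Qed.

Section flow_average.
Variables (R : realType) (n : nat) (M : topologicalType).
Variables (X : smooth_manifold R n M) (g : riemannian_metric X).
Variables (phi : R -> M -> M) (omega : M -> R) (a e K L b : R).
Hypotheses (Cphi : forall t, C1_map X (phi t)) (Comega : C1_fun X omega)
  (cphi : forall m, continuous (fun t => omega (phi t m)))
  (omegab : forall m, `|omega m| <= b).
Hypotheses (e0 : 0 < e) (ea : e < a) (K0 : 0 <= K) (L0 : 0 <= L)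
  (dphi : forall t m, 0 <= t ->
     (tangent_map_norm g (phi (- t)%R) m <= (K * expR (e * t))%:E)%E)
  (domega : forall m, (tangent_fun_norm g omega m <= L%:E)%E).

(** The operator norm bound is used twice: for the differential of [omega] at the point phi^{-t}(m),
    then for the tangent map of phi^{-t} at m. *)
Lemma diff_along_flow_bound (c : chart R n M) (x v : 'cV[R]_n) (t : R) :
  atlas X c -> (c @` chart_dom c) x -> 0 <= t ->
  `|'d (omega \o phi (- t) \o chart_inv c) x v| <=
  L * (K * expR (e * t)) * metric_norm g (of_chart X c x v).
Proof.
move=> Xc Ux t0; rewrite (diff_comp_tangent_map Comega (Cphi (- t)) Xc v Ux).
set m := chart_inv c x; set w := of_chart X c x v.
(* [tangent_fun] unfolds to this differential; naming it explicitly exhibits the linear map that the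
   lemma asks for. *)
have H1 := op_norm_bound (q := fun y : R => `|y|)
  (T := 'd (omega \o chart_inv (chart_at X (phi (- t) m)))
           (chart_at X (phi (- t) m) (phi (- t) m)))
  (tangent_map X (phi (- t)) w) (fun a w => normrM a w) (domega (phi (- t) m)).
apply: le_trans H1 _; rewrite -mulrA ler_wpM2l //.
exact: (op_norm_bound (q := @metric_norm _ _ _ _ g (phi (- t) m))
  (T := 'd (chart_at X (phi (- t) m) \o phi (- t) \o chart_inv (chart_at X m))
           (chart_at X m m))
  w (@metric_normZ _ _ _ _ g (phi (- t) m)) (dphi m t0)).
Qed.

Lemma C1_discounted_average : C1_fun X (discounted_average phi omega a).
Proof.
move=> c Xc; set U := c @` chart_dom c.
have oU : open U by exact: chart_img_open.
have a0 : 0 < a := lt_trans e0 ea.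
(* The weight e^{- a t} is placed as the constant vector of a scaling, so that [Ck1_scalel] and
   [diffZl] apply. *)
pose u t x := (omega \o phi (- t) \o chart_inv c) x *: expR (- (a * t)).
have uC t : Ck 1 U (u t).
  by apply: Ck1_scalel => //; exact: (Ck1_comp_C1_map Comega (Cphi (- t)) Xc).
have duE t x v : U x -> 'd (u t) x v =
    'd (omega \o phi (- t) \o chart_inv c) x v * expR (- (a * t)).
  move=> Ux; have [dw _] := Ck1_comp_C1_map Comega (Cphi (- t)) Xc.
  exact: (congr1 (@^~ v) (diffZl (expR (- (a * t))) (dw x Ux))).
have -> : discounted_average phi omega a \o chart_inv c =
    fun x => Rintegral (@lebesgue_measure R) `[0, +oo[ (u ^~ x).
  apply/funext => x; apply: eq_Rintegral => t _; exact: mulrC.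
apply: Ck1_Rintegral => //.
- by move=> t x _ Ux; exact: (uC t).1.
- by move=> t v x _ Ux; exact: (uC t).2.
(* Integrability holds even at points outside the image of the chart, since [omega] is bounded and
   continuous along every orbit of [M]. *)
- move=> x; have := integrable_discounted cphi omegab (chart_inv c x) a0.
  by apply: eq_integrable => // t _; rewrite /u /= mulrC.
move=> x0 Ux0; have [q [q0 nq]] := metric_norm_of_chart_bound g Xc Ux0.
have nU : \forall x \near x0, U x by exact: open_nbhs_nbhs.
have nUq : nbhs x0 [set x | U x /\
    forall v, metric_norm g (of_chart X c x v) <= q * `|v|].
  exact: (@filterI _ _ (nbhs_filter x0) _ _ nU nq).
have [r /= r0 rU] := proj1 (nbhs_ballP _ _) nUq.
(* [L] bounds the differential of [omega], K e^{e t} that of the backward flow, and [q] the passage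
   from coordinates to the metric. With the weight e^{- a t} the rate is a - e > 0. *)
exists (fun t => L * K * q * expR (- ((a - e) * t))), r; split=> //.
- apply: (@integrable_expRN_dominated _ _ (a - e) (L * K * q)).
  + by rewrite subr_gt0.
  + by apply: measurable_funM => //; exact: measurable_expRN_linear.
  + move=> t t0; rewrite ger0_norm // mulr_ge0 ?expR_ge0 //.
    by rewrite !mulr_ge0.
- by move=> x /rU[].
- move=> t x v; rewrite /= in_itv /= andbT => t0 /rU[Ux qx].
  rewrite duE // normrM (ger0_norm (expR_ge0 _)).
  apply: (@le_trans _ _ (L * (K * expR (e * t)) * (q * `|v|) * expR (- (a * t)))).
    rewrite ler_wpM2r ?expR_ge0 //.
    apply: le_trans (diff_along_flow_bound v Xc Ux t0) _.
    by rewrite ler_wpM2l // !mulr_ge0 ?expR_ge0.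
  rewrite le_eqVlt; apply/orP; left; apply/eqP.
  have -> : expR (- ((a - e) * t)) = expR (e * t) * expR (- (a * t)).
    by rewrite -expRD; congr expR; ring.
  by ring.
Qed.

End flow_average.

Theorem proposition4p2 (R : realType) (n N : nat) (M : topologicalType)
  (X : smooth_manifold R n M) (g : riemannian_metric X)
  (V : forall m : M, tangent R n m) (phi : R -> M -> M)
  (A : 'M[R]_N) (C : 'cV[R]_N) (omega : M -> R) (c K : R)
  (hN : (0 < N)%N)
  (hV : smooth_vector_field X V)
  (hphi : is_flow X V phi)
  (hphi1 : forall t : R, C1_diffeo X (phi t))
  (hA : sym_posdef A)
  (homega : C1_fun X omega)
  (hc0 : 0 < c) (hc1 : c < 1) (hK : 0 < K)
  (hTphi : forall t : R, 0 <= t ->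
     (ereal_sup [set tangent_map_norm g (phi (- t)%R) m | m in [set: M]]
      <= (K * expR (c * min_eigenvalue A * t))%:E)%E)
  (hDomega :
     (ereal_sup [set tangent_fun_norm g omega m | m in [set: M]] < +oo)%E)
  (homegab : (ereal_sup [set `|omega m|%:E | m in [set: M]] < +oo)%E) :
  [/\ forall (m : M) (i : 'I_N),
        (@lebesgue_measure R).-integrable `[0, +oo[
          (EFin \o (fun tau : R => sync_integrand phi omega A C m tau i 0)),
      generalised_synchronisation phi omega (linear_reservoir A C)
        (sync_map phi omega A C) &
      C1_fun X (sync_map phi omega A C)].
Proof.
have [P [d [P1 AP PA Ad]]] := symmetric_spectral_resolution hA.1.
have [phi0 phiD cphi _] := hphi.
have s0 : 0 < min_eigenvalue A := min_eigenvalue_gt0 hN hA P1 AP Ad.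
have sd l : min_eigenvalue A <= d l := min_eigenvalue_le hA (Ad l).
have d0 l : 0 < d l := lt_le_trans s0 (sd l).
have cwphi m : continuous (fun t => omega (phi t m)).
  move=> t; apply: (continuous_comp (cphi m t)).
  exact: (C1_fun_continuous homega).
have [b [_ omegab']] := ereal_sup_bound homegab.
have omegab m : `|omega m| <= b by rewrite -lee_fin.
have [L [L0 domega]] := ereal_sup_bound hDomega.
have Cphi t : C1_map X (phi t) by have [? [_ _ ? _]] := hphi1 t.
split.
- by move=> m i; exact: (integrable_sync_integrand _ P1 AP d0 cwphi omegab).
- move=> r m; split.
    exact: (reservoir_solution_exists _ P1 AP d0 phi0 phiD cwphi omegab).
  by move=> x; exact: (sync_map_attracts P1 AP PA d0 phiD cwphi omegab).
move=> c' Xc'.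
have -> : sync_map phi omega A C \o chart_inv c' = fun x =>
    \sum_l (discounted_average phi omega (d l) \o chart_inv c') x *: (P l *m C).
  by rewrite (sync_map_spectral _ P1 AP d0 cwphi omegab).
apply: Ck1_lincomb => [|l]; first exact: chart_img_open.
(* The growth rate [e] is c times the smallest eigenvalue, which lies strictly below every [d l]
   because c < 1. *)
apply: (@C1_discounted_average _ _ _ _ g _ _ _ (c * min_eigenvalue A) K L b) => //.
- exact: mulr_gt0.
- by apply: lt_le_trans (sd l); rewrite gtr_pMl.
- exact: ltW.
- move=> t m t0; apply: le_trans (hTphi t t0).
  by apply: ereal_sup_ubound; exists m.
Qed.
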